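(* Let $G$ be a finite soluble group. Let $L$ be its derived length and let \[ \varepsilon_0=\max\{\exp(G^{(i)}/G^{(i+1)}) : 0\le i<L\}\le \exp(G). \] Then \[ \operatorname{diam}(G)\le \varepsilon_0\,4^{L-1}(\log_2|G|)^2\le \varepsilon_0\,(4\log_2|G|)^8 . \]
   Context: For a group $G$ and $X\subseteq G$, $\ell_X(g)$ is the minimal length of an expression of $g$ as a product of elements of $X\cup X^{-1}$ ($\infty$ if none exists). For a finite group $G$ with generating set $X$, $\operatorname{diam}(G,X)=\max_{g\in G}\ell_X(g)$, and $\operatorname{diam}(G)=\max\{\operatorname{diam}(G,X): X \text{ a generating set for } G\}$. The derived series is $G^{(0)}=G$, $G^{(i)}=[G^{(i-1)},G^{(i-1)}]$ for $i\ge1$; the derived length $L$ is the least $i$ with $G^{(i)}=1$. The exponent $\exp(H)$ is the least positive integer $e$ with $h^e=1$ for all $h\in H$. If $G$ is trivial ($L=0$), set $\varepsilon_0=1$. *)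

(* Defs.v *)
From mathcomp Require Import all_boot all_order all_algebra all_fingroup all_solvable.
From mathcomp Require Import all_classical all_reals all_analysis.

Set Implicit Arguments.
Unset Strict Implicit.
Unset Printing Implicit Defensive.

Import Order.TTheory GRing.Theory Num.Theory GroupScope.

Definition is_word (gT : finGroupType) (X : {set gT}) (g : gT) (w : seq gT) : Prop :=
  {subset w <= X :|: X^-1} /\ \prod_(x <- w) x = g.

(* The infimum of the empty set is +oo, and a nonempty set of naturals attains
   its infimum. *)
Definition word_length (R : realType) (gT : finGroupType) (X : {set gT}) (g : gT) :
    \bar R :=
  ereal_inf [set ((size w)%:R%:E)%E | w in [set w | is_word X g w]%classic]%classic.

(* In the two maxima below -oo is the neutral element of maxe; the index sets
   are never empty, as 1 \in G and G generates itself. *)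
Definition diam_wrt (R : realType) (gT : finGroupType) (G X : {set gT}) : \bar R :=
  (\big[maxe/-oo]_(g in G) word_length R X g)%E.

Definition diam (R : realType) (gT : finGroupType) (G : {set gT}) : \bar R :=
  (\big[maxe/-oo]_(X : {set gT} | <<X>> == G) diam_wrt R G X)%E.

(* For soluble G the derived series strictly decreases until it reaches 1, so
   its first #|G| terms include 1; see [derived_lengthP]. *)
Definition derived_length (gT : finGroupType) (G : {set gT}) : nat :=
  index 1 (mkseq (fun i => G^`(i)) #|G|).

Lemma derived_lengthP (gT : finGroupType) (G : {group gT}) : solvable G ->
  G^`(derived_length G) = 1 /\ forall i, G^`(i) = 1 -> (derived_length G <= i)%N.
Proof.
move=> solG.
have card_der i : (#|G^`(i)| <= maxn 1 (#|G| - i))%N.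
  elim: i => [|i IHi]; first by rewrite subn0 leq_max leqnn orbT.
  have [der1 | ntder] := eqVneq (G^`(i)%G : {set gT}) 1.
    rewrite leq_max; apply/orP; left.
    by rewrite dergSn (_ : G^`(i) = 1) // commG1 cards1.
  have : G^`(i.+1) \proper G^`(i).
    by rewrite dergSn (sol_der1_proper solG) ?der_sub.
  move/proper_card => lt_der.
  have gt1 : (1 < #|G^`(i)|)%N by rewrite cardG_gt1.
  move: IHi; rewrite !leq_max => /orP[le1 | leGi].
    by move: (leq_trans gt1 le1); rewrite ltnn.
  apply/orP; right; rewrite subnS -ltnS (leq_trans lt_der) //.
  exact: (leq_trans leGi (leqSpred _)).
have in_der : (1 : {set gT}) \in mkseq (fun i => G^`(i)) #|G|.
  have last1 : G^`(#|G|.-1) = 1.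
    apply/eqP; rewrite trivg_card_le1.
    by apply: leq_trans (card_der _) _; rewrite geq_max leq_subLR addn1 prednK ?cardG_gt0 ?leqnn.
  apply/mapP; exists #|G|.-1; last by rewrite last1.
  by rewrite mem_iota /= add0n prednK ?cardG_gt0.
split.
  have := nth_index 1 in_der; rewrite nth_mkseq //.
  by move: in_der; rewrite -index_mem size_mkseq.
move=> i deri1; have [ltiG | leGi] := ltnP i #|G|.
  rewrite leqNgt; apply/negP => lti.
  have := before_find 1 lti.
  by rewrite nth_mkseq //= deri1 eqxx.
by apply: leq_trans leGi; rewrite -[X in (_ <= X)%N](size_mkseq (fun i => G^`(i))) index_size.
Qed.

Definition eps0 (gT : finGroupType) (G : {set gT}) : nat :=
  if derived_length G == 0%N then 1%N
  else (\max_(i < derived_length G) exponent (G^`(i) / G^`(i.+1)))%N.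

Definition log2 (R : realType) (x : R) : R := (ln x / ln 2)%R.

(* Main.v *)
(** Diameter.  Let N be the integer part of log2 |G|.  If Y generates G^(i) and
    consists of words of length at most c in the generators X, then G^(i+1) is
    the normal closure of the commutators of Y, which are words of length 4c.
    Conjugating repeatedly by elements of X enlarges the generated subgroup
    until it is normal, which takes at most log2 |G^(i+1)| <= N - 1 steps, so G^(i+1)
    is generated by words of length at most 4c + 2(N - 1).  By induction
    G^(i) is generated by words of length at most 4^i N.  In the abelian group
    G^(i) / G^(i+1) every element is a product of powers, with exponents below
    eps0, of at most log2 |G^(i) / G^(i+1)| of these generators.

    Derived length.  It suffices that 2^L <= 32 N^3.  Let H be a soluble group
    acting faithfully and irreducibly on a space of dimension n over a finite
    field F.  Then 2^dl(H) <= C n^2, with C = 4 if |F| = 2 and C = 16 otherwise.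
    Let A be a maximal abelian normal subgroup.
    - If the restriction to A has m > 1 homogeneous components, then H permutes
      them transitively and induction applies to the stabiliser of one of them.
      A soluble transitive group of degree m has 2^dl <= m^2: reduce to a
      primitive group, which is an extension of a vector space of order m by an
      irreducible linear group.
    - Otherwise F[A] is a field, of degree e over F say, and n = e t.  If B/A is
      a chief factor centralised by A, the elements of a transversal of A in B
      are linearly independent over F[A] inside the commutant of A, so that
      |B/A| <= t^2.  If H^(r) centralises all these chief factors, then H^(r+1)
      centralises every such B, so it lies in A by maximality of A, and the
      derived length is at most r + 2.
    Hence G^(a), with 2^a <= 16 N^2 maximal, centralises all chief factors of G
    and is nilpotent of class at most N; and the k-th derived subgroup of a group
    lies in the 2^k-th term of its lower central series. *)

Require Import Defs.
From mathcomp Require Import all_boot all_order all_algebra all_fingroup all_solvable.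
From mathcomp Require Import all_field all_character zify.

Set Implicit Arguments.
Unset Strict Implicit.
Unset Printing Implicit Defensive.

(* For |F| = 2 the field F[A] is larger than F unless A = 1; the factor 4 gained
   there is what makes the induction close for chief factors of 2-power order. *)
Definition irr_const q := if q == 2 then 4 else 16.

Definition irr_der_bound q n := trunc_log 2 (irr_const q * n ^ 2).

(* irr_der_bound is too weak for the very small chief factors: there use that
   the automorphism group is abelian, or that |GL_2(2)| = 6 < 2^3 and
   |GL_2(3)| = 48 < 2^6. *)
Definition chief_der_bound q j :=
  if j == 1 then q != 2 : nat
  else if q ^ j == 4 then 2 else if q ^ j == 9 then 5
  else irr_der_bound q j.

(** * Arithmetic of the derived length bounds *)

Lemma sqr_leq_exp2 j : 3 < j -> j ^ 2 <= 2 ^ j.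
Proof.
elim: j => // j IHj; rewrite ltnS leq_eqVlt => /predU1P[<- //|gt3].
have := IHj gt3; rewrite -!mulnn expnS; move: (_ ^ j) => x; clear IHj; nia.
Qed.

Lemma sqr_lt_exp2S n : n ^ 2 < 2 ^ n.+1.
Proof.
have [|le3] := ltnP 3 n; last by case: n le3 => [|[|[|[|]]]].
by move/sqr_leq_exp2 => le_n; rewrite [2 ^ _]expnS mul2n -addnn; have := expn_gt0 2 n; lia.
Qed.

Lemma sqr_lt_exp3 n : n ^ 2 < 3 ^ n.
Proof.
have [gt3|le3] := ltnP 3 n; last by case: n le3 => [|[|[|[|]]]].
apply: leq_ltn_trans (sqr_leq_exp2 gt3) _.
by rewrite ltn_exp2r // (ltn_trans _ gt3).
Qed.

Lemma sqr4_leq_exp3 j : 3 < j -> 4 * j ^ 2 <= 3 ^ j.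
Proof.
elim: j => // j IHj; rewrite ltnS leq_eqVlt => /predU1P[<- //|gt3].
have := IHj gt3; rewrite -!mulnn expnS; move: (_ ^ j) => x; clear IHj; nia.
Qed.

Lemma irr_der_boundP q n : 0 < n -> 2 ^ irr_der_bound q n <= irr_const q * n ^ 2.
Proof.
by move=> n0; apply: trunc_logP => //; rewrite muln_gt0 expn_gt0 n0 /irr_const; case: ifP.
Qed.

(** For chief factors [B / A] with [#|B : A| <= t ^ 2]. In general
    [irr_const q * j ^ 2 <= 4 * q ^ j]; apart from the special cases of the definition, only the
    orders 8 and 27 are left to computation. *)
Lemma chief_der_bound_homogeneous q j t : prime q -> 0 < j -> q ^ j <= t ^ 2 ->
  2 ^ chief_der_bound q j <= 4 * t ^ 2.
Proof.
move=> pr_q j_gt0 le_t; rewrite /chief_der_bound.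
have t_gt0 : 0 < t ^ 2 by apply: leq_trans le_t; rewrite expn_gt0 prime_gt0.
case: eqP => [_|/eqP j1]; first by case: (q != 2); rewrite ?expn1 ?expn0; lia.
case: eqP => [q4|/eqP q4]; first by rewrite q4 in le_t; lia.
case: eqP => [q9|/eqP q9]; first by rewrite q9 in le_t; lia.
have [jle|jgt] := leqP j 3; last first.
  apply: leq_trans (irr_der_boundP q j_gt0) _; rewrite /irr_const.
  have [q2|qn2] := eqVneq q 2.
    by rewrite leq_mul2l /= (leq_trans _ le_t) // q2 sqr_leq_exp2.
  have q_ge3 : 3 <= q by have := prime_gt1 pr_q; lia.
  rewrite (_ : 16 = 4 * 4) // -mulnA leq_mul2l /= (leq_trans _ le_t) //.
  by rewrite (leq_trans (sqr4_leq_exp3 jgt)) // leq_exp2r.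
have [q_ge5|q_lt5] := leqP 5 q.
  apply: leq_trans (irr_der_boundP q j_gt0) _; rewrite /irr_const.
  rewrite ifN; last lia.
  rewrite (_ : 16 = 4 * 4) // -mulnA leq_mul2l /= (leq_trans _ le_t) //.
  apply: (@leq_trans (5 ^ j)); last by rewrite leq_exp2r.
  by case: j jle j_gt0 j1 {le_t q4 q9} => [|[|[|[|]]]].
have q23 : q = 2 \/ q = 3.
  by case: q pr_q q_lt5 {le_t q4 q9} => [|[|[|[|[|]]]]] //; auto.
have j23 : j = 2 \/ j = 3 by lia.
case: q23 j23 le_t q4 q9 => -> [] -> //= le_t _ _; rewrite /irr_der_bound /=.
  have t3 : 3 <= t by move: le_t; rewrite -mulnn; nia.
  by rewrite (_ : trunc_log 2 (4 * 9) = 5) //; move: t3; rewrite -mulnn; nia.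
(* Integrality of t matters: 2 ^ 7 exceeds 4 * 27 but not 4 * 6 ^ 2. *)
have t6 : 6 <= t by move: le_t; rewrite -mulnn; nia.
by rewrite (_ : trunc_log 2 (16 * 9) = 7) //; move: t6; rewrite -mulnn; nia.
Qed.

(** The extra 1 pays for the derived step through V itself in a primitive group of degree
    [#|V| = q ^ j]. *)
Lemma chief_der_bound_primitive q j : prime q -> 0 < j ->
  2 ^ (chief_der_bound q j).+1 <= (q ^ j) ^ 2.
Proof.
move=> pr_q j_gt0; rewrite /chief_der_bound.
have q_gt1 := prime_gt1 pr_q.
case: eqP => [->|/eqP j1].
  by rewrite expn1 -mulnn; case: eqP => /= [->|] //; nia.
case: eqP => [->//|/eqP q4].
case: eqP => [->//|/eqP q9].
have lt_irr m : irr_const q * j ^ 2 < m -> forall k, m = 2 ^ k -> irr_der_bound q j < k.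
  move=> ltm k def_m; rewrite -(ltn_exp2l _ _ (ltnSn 1)).
  by apply: leq_ltn_trans (irr_der_boundP q j_gt0) _; rewrite -def_m.
rewrite expnS; have [q2|qn2] := eqVneq q 2.
  have [jle|jgt] := leqP j 3.
    have j3 : j = 3 by case: j jle j1 j_gt0 q4 {q9 lt_irr} => [|[|[|[|]]]] //; rewrite q2.
    (* Order 8 is tight: 2 * 36 exceeds 8 ^ 2, but truncating the logarithm leaves 2 ^ 6. *)
    by rewrite q2 j3.
  have := irr_der_boundP q j_gt0; rewrite /irr_const q2 /=; have := sqr_leq_exp2 jgt.
  have : 2 ^ 4 <= 2 ^ j by rewrite leq_exp2l.
  rewrite -!mulnn; nia.
have q_ge3 : 3 <= q by lia.
have := irr_der_boundP q j_gt0; rewrite /irr_const (negPf qn2).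
have [jle|jgt] := leqP j 3; last first.
  have := sqr4_leq_exp3 jgt; have : 3 ^ j <= q ^ j by rewrite leq_exp2r.
  have : 3 ^ 4 <= 3 ^ j by rewrite leq_exp2l.
  rewrite -!mulnn; nia.
have [q_ge5|q_lt5] := leqP 5 q.
  have : 5 ^ j <= q ^ j by rewrite leq_exp2r.
  have j23 : j = 2 \/ j = 3 by lia.
  case: j23 => ->; rewrite -!mulnn => h1 h2; apply: leq_trans (leq_mul (leqnn 2) h2) _.
    by apply: leq_trans (leq_mul h1 h1).
  by apply: leq_trans (leq_mul h1 h1).
have q3 : q = 3 by case: q pr_q q_lt5 q_ge3 {q_gt1 q4 q9 lt_irr qn2} => [|[|[|[|[|]]]]].
have j3 : j = 3 by case: j jle j1 j_gt0 q9 {q4 lt_irr} => [|[|[|[|]]]] //; rewrite q3.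
by rewrite q3 j3 => h; apply: leq_trans (leq_mul (leqnn 2) h) _.
Qed.

(** Lets derived lengths be added along a chain of subgroups (c = 1) or from blocks to the whole
    space (c = [irr_const]). *)
Lemma trunc_log2_sqrM m1 m2 c : 0 < m1 -> 0 < m2 -> 0 < c ->
  trunc_log 2 (m1 ^ 2) + trunc_log 2 (c * m2 ^ 2) <= trunc_log 2 (c * (m1 * m2) ^ 2).
Proof.
move=> m1_gt0 m2_gt0 c_gt0; apply: trunc_log_max => //; rewrite expnD.
have le1 := trunc_logP (ltnSn 1) (_ : 0 < m1 ^ 2).
have le2 := trunc_logP (ltnSn 1) (_ : 0 < c * m2 ^ 2).
have le3 := leq_mul (le1 _) (le2 _); apply: leq_trans (le3 _ _) _.
- by rewrite expn_gt0 m1_gt0.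
- by rewrite muln_gt0 c_gt0 expn_gt0 m2_gt0.
by rewrite mulnCA expnMn.
Qed.

Import GRing.Theory GroupScope.

(** * Irreducible soluble linear groups *)

Lemma Clifford_basis_rank (F : fieldType) (gT : finGroupType) (G H : {group gT}) n
    (rG : mx_representation F G n) (nsHG : H <| G) (M : 'M_n) :
    mx_irreducible rG -> mxsimple (subg_repr rG (normal_sub nsHG)) M ->
  exists X : {set gT},
    [/\ X \subset G, (\sum_(x in X) (M *m rG x)%R :=: 1%:M%R)%MS & n = (#|X| * \rank M)%N].
Proof.
move=> irrG simM; have [X sXG [defV dxV]] := Clifford_basis irrG simM.
exists X; split=> //; rewrite -[LHS](mxrank1 F) -defV (mxdirectP dxV) /= -sum_nat_const.
by apply: eq_bigr => x /(subsetP sXG) Gx; rewrite mxrankMfree // repr_mx_free.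
Qed.

Lemma mem_repr_rcosets (gT : finGroupType) (A B : {group gT}) C :
  A \subset B -> C \in rcosets A B -> repr C \in B.
Proof.
move=> sAB /rcosetsP[b Bb ->].
by apply: (subsetP (mul_subG sAB _)) (mem_repr_rcoset A b); rewrite sub1set.
Qed.

(** * Abelian normal subgroups with homogeneous restriction *)

Section Homogeneous.
Local Open Scope ring_scope.

Variables (F : finFieldType) (gT : finGroupType) (G A : {group gT}) (n : nat).
Variable rG : mx_representation F G n.
Hypotheses (nsAG : A <| G) (cAA : abelian A) (irrG : mx_irreducible rG).
Let rA := subg_repr rG (normal_sub nsAG).
Local Notation E_A := (enveloping_algebra_mx rA).
Hypothesis homA :
  forall M1 M2 : 'M_n, mxsimple rA M1 -> mxsimple rA M2 -> mx_iso rA M1 M2.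

(** F[A] is a field: the kernel of a singular a is an A-module, so it contains a simple one. As a
    commutes with isomorphisms of A-modules, it kills all conjugates of that module, and these span
    the space. *)
Lemma homogeneous_envelop_unit a : (a \in E_A)%MS -> a != 0 -> a \in unitmx.
Proof.
move=> Ea nz_a.
have cAa : centgmx rA a.
  apply/centgmxP => x Ax; have /envelop_mxP[c ->] := Ea.
  rewrite mulmx_suml mulmx_sumr; apply: eq_bigr => y Ay.
  by rewrite -scalemxAl -scalemxAr -!repr_mxM // (centsP cAA).
apply: contraR nz_a => singa.
have nzK : kermx a != 0.
  by rewrite kermx_eq0 row_free_unit.
apply: (mxsimple_exists (kermx_centg_module cAa) nzK) => -[M simM sMK].
have [X sXG [defV _]] := Clifford_basis irrG simM.
rewrite -[a]mul1mx -submx0 -(eqmxMr a defV) sumsmxMr; apply/sumsmx_subP => x Xx.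
have Gx := subsetP sXG x Xx.
have [f injf homMf defMx] := homA simM (Clifford_simple simM Gx).
rewrite -(eqmxMr a defMx) -(hom_envelop_mxC homMf Ea).
by move/sub_kermxP: sMK => ->; rewrite mul0mx sub0mx.
Qed.

Hypothesis ffulG : mx_faithful rG.
Variable B : {group gT}.
Hypotheses (sAB : A \subset B) (sBG : B \subset G).
Hypotheses (cAB : B \subset 'C(A)) (derB : B^`(1)%g \subset A).
Hypothesis (centB : 'C_B(B)%g \subset A).

(* Subtracting a conjugate by a suitable y in B shortens a minimal relation, as
   y multiplies each representative by a commutator lying in A. *)
Lemma rcosets_envelop_free (c : {set gT} -> 'M[F]_n) :
    {in rcosets A B, forall C, (c C \in E_A)%MS} ->
    \sum_(C in rcosets A B) c C *m rG (repr C) = 0 ->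
  {in rcosets A B, forall C, c C = 0}.
Proof.
have [k] := ubnP #|[set C in rcosets A B | c C != 0]|.
elim: k c => // k IHk c /ltnSE-le_k Ec sum0.
have repB C : C \in rcosets A B -> repr C \in B := mem_repr_rcosets sAB.
have repC C : C \in rcosets A B -> C = A :* repr C.
  by case/rcosetsP=> b Bb ->; rewrite rcoset_repr.
have GB b : b \in B -> b \in G by apply: subsetP.
have inA b y : b \in B -> y \in B -> [~ b, y]%g \in A.
  by move=> Bb By; apply: (subsetP derB); apply: mem_commg.
have [C1 C1B | all0] := pickP (fun C => (C \in rcosets A B) && (c C != 0)); last first.
  by move=> C CB; have:= all0 C; rewrite CB /= => /eqP.
case/andP: C1B => C1B nz1.
pose b1 := repr C1.
have [C2 /and3P[C2B ne12 nz2] | only1] :=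
  pickP (fun C => [&& C \in rcosets A B, C != C1 & c C != 0]); last first.
  case/eqP: nz1; move: sum0; rewrite (bigD1 C1) //= big1 => [|C /andP[CB neC]].
    rewrite addr0 => /(congr1 (fun m => m *m rG (repr C1)^-1%g)).
    by rewrite mul0mx repr_mxK ?GB ?repB.
  by have:= only1 C; rewrite CB neC /= => /negbFE/eqP->; rewrite mul0mx.
pose b2 := repr C2.
have Bb1 : b1 \in B := repB _ C1B.
have Bb2 : b2 \in B := repB _ C2B.
(* Otherwise b1 * b2^-1 centralises B, hence lies in A, and the two cosets agree. *)
have [y By ney] : exists2 y, y \in B & [~ b1, y] != [~ b2, y].
  apply/exists_inP; apply: contraR ne12 => /exists_inPn eqy.
  rewrite (repC _ C1B) (repC _ C2B); apply/eqP/rcoset_eqP.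
  rewrite mem_rcoset; apply: (subsetP centB); rewrite inE groupM ?groupV //=.
  apply/centP => y By; have /eqP e12 := negbNE (eqy y By).
  apply/commgP/conjg_fixP.
  rewrite conjMg conjVg -/b1 -/b2.
  have -> : (b1 ^ y = b1 * [~ b1, y])%g by rewrite mulKVg.
  have -> : (b2 ^ y = b2 * [~ b2, y])%g by rewrite mulKVg.
  by rewrite e12 invMg mulgA mulgK.
(* The coefficients of the relation conjugated by y, minus [rG [~ b1, y]] times the relation. The
   one at C1 vanishes and no new ones appear. *)
pose d C := c C *m (rG [~ repr C, y] - rG [~ b1, y]).
have d_c C : c C = 0 -> d C = 0 by rewrite /d => ->; rewrite mul0mx.
have Ed : {in rcosets A B, forall C, (d C \in E_A)%MS}.
  move=> C CB; apply: envelop_mxM; first exact: Ec.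
  by rewrite linearB addmx_sub ?eqmx_opp //; apply: (envelop_mx_id rA); rewrite inA ?repB.
have sumd : \sum_(C in rcosets A B) d C *m rG (repr C) = 0.
  have -> : \sum_(C in rcosets A B) d C *m rG (repr C) =
      rG y^-1%g *m (\sum_(C in rcosets A B) c C *m rG (repr C)) *m rG y
      - rG [~ b1, y] *m (\sum_(C in rcosets A B) c C *m rG (repr C)).
    rewrite mulmx_sumr mulmx_suml mulmx_sumr -sumrB; apply: eq_bigr => C CB.
    have BC := repB _ CB.
    have cE z : z \in B -> c C *m rG z = rG z *m c C.
      move=> Bz; have /envelop_mxP[e ->] := Ec C CB.
      rewrite mulmx_suml mulmx_sumr; apply: eq_bigr => x Ax.
      have Bx := subsetP sAB x Ax.
      rewrite -scalemxAl -scalemxAr -[rA x]/(rG x) -!repr_mxM ?GB //.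
      by rewrite (centP (subsetP cAB z Bz) x Ax).
    rewrite /d mulmxBr mulmxBl; congr (_ - _).
      rewrite !mulmxA -cE ?groupV // -!mulmxA; congr (_ *m _).
      rewrite -!repr_mxM ?groupM ?groupV ?GB ?groupR //.
      congr (rG _); rewrite -(centP (subsetP cAB _ BC) _ (inA _ _ BC By)) //.
      by rewrite mulKVg conjgE mulgA.
    by rewrite !mulmxA cE // groupR.
  by rewrite sum0 !mulmx0 mul0mx subr0.
have: d C2 = 0.
  apply: IHk Ed sumd _ C2B; apply: leq_trans le_k; apply: proper_card.
  apply/properP; split.
    by apply/subsetP => C; rewrite !inE => /andP[-> /=]; apply: contraNN => /eqP/d_c->.
  by exists C1; rewrite !inE C1B //= /d subrr mulmx0 eqxx.
have Udc : c C2 \in unitmx by rewrite homogeneous_envelop_unit ?Ec.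
move/(congr1 (mulmx (invmx (c C2)))); rewrite mulmx0 mulKmx // => /subr0_eq eqr.
case/eqP: ney; apply: esym.
by apply: (mx_faithful_inj ffulG); rewrite ?GB ?groupR.
Qed.

Variable M : 'M[F]_n.
Hypothesis simM : mxsimple rA M.

(** Evaluation at a nonzero vector of M maps F[A] onto M. *)
Lemma card_envelop_ge : (#|F| ^ \rank M <= #|[set a | (a \in E_A)%MS]|)%N.
Proof.
have [modM nzM minM] := simM.
rewrite -card_rowg.
pose u := nz_row M.
have sMu : (M <= cyclic_mx rA u)%MS.
  apply: minM; rewrite ?cyclic_mx_module ?cyclic_mx_sub ?nz_row_sub //.
  by rewrite cyclic_mx_eq0 nz_row_eq0.
apply: leq_trans (leq_imset_card (mulmx u) _).
apply: subset_leq_card; apply/subsetP => v; rewrite inE => vM.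
have /cyclic_mxP[a Ea ->] := submx_trans vM sMu.
by apply/imsetP; exists a; rewrite ?inE.
Qed.

(* Counts the F[A]-combinations of coset representatives: as they commute with A,
   they are determined by their values on generators of the n %/ \rank M simple
   A-modules into which the whole space splits. *)
Lemma index_homogeneous_le : (#|B : A| <= (n %/ \rank M) ^ 2)%N.
Proof.
have [modM nzM minM] := simM.
have [X [sXG defV def_n]] := Clifford_basis_rank irrG simM.
have e_gt0 : (0 < \rank M)%N by rewrite lt0n mxrank_eq0.
have -> : (n %/ \rank M = #|X|)%N by rewrite [X in (X %/ _)%N]def_n mulnK.
have F_gt1 : (1 < #|F|)%N by rewrite (cardD1 0) (cardD1 1) !inE oner_eq0.
pose D := rcosets A B; pose E := [set a | (a \in E_A)%MS].
pose u x := nz_row M *m rG x.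
pose phi (c : {ffun {set gT} -> 'M[F]_n}) := \sum_(C in D) c C *m rG (repr C).
pose Phi c := [ffun x => if x \in X then u x *m phi c else 0].
have GB b : b \in B -> b \in G by apply: subsetP.
have repB C : C \in D -> repr C \in B := mem_repr_rcosets sAB.
have injPhi : {in pffun_on 0 D E &, injective Phi}.
  move=> c1 c2 /pffun_onP[sc1 Ec1] /pffun_onP[sc2 Ec2] eqPhi.
  pose c := [ffun C => c1 C - c2 C].
  have Ec : {in D, forall C, (c C \in E_A)%MS}.
    move=> C CD; rewrite ffunE linearB addmx_sub ?eqmx_opp //.
      by have := Ec1 _ (image_f c1 CD); rewrite inE.
    by have := Ec2 _ (image_f c2 CD); rewrite inE.
  have phic : phi c = phi c1 - phi c2.
    by rewrite -sumrB; apply: eq_bigr => C _; rewrite ffunE mulmxBl.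
  have cphi : centgmx rA (phi c).
    apply/centgmxP => a Aa; rewrite mulmx_suml mulmx_sumr; apply: eq_bigr => C CD.
    have /envelop_mxP[e ->] := Ec C CD.
    rewrite !mulmx_suml mulmx_sumr; apply: eq_bigr => x Ax.
    rewrite -!scalemxAl -scalemxAr -[rA x]/(rG x) -[rA a]/(rG a).
    have Ba := subsetP sAB a Aa; have Bx := subsetP sAB x Ax.
    rewrite -!repr_mxM ?GB ?groupM ?repB // -!mulgA.
    rewrite (centP (subsetP cAB _ (repB _ CD)) a Aa) mulgA.
    by rewrite (centsP cAA x Ax a Aa) -mulgA.
  (* [phi c] commutes with A and kills a nonzero vector of each simple summand, so its kernel
     contains every summand. *)
  have phi0 : phi c = 0.
    rewrite -[phi c]mul1mx; apply/eqP; rewrite -submx0 -(eqmxMr _ defV) sumsmxMr.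
    apply/sumsmx_subP => x Xx; have Gx := subsetP sXG x Xx.
    rewrite submx0; apply/eqP/sub_kermxP.
    have [modMx nzMx minMx] := Clifford_simple simM Gx.
    apply: submx_trans (capmxSr (M *m rG x) _); apply: minMx.
    + by rewrite capmx_module // kermx_centg_module.
    + exact: capmxSl.
    apply/rowV0Pn; exists (u x).
      rewrite sub_capmx submxMr ?nz_row_sub //=; apply/sub_kermxP.
      rewrite phic mulmxBr; apply/eqP; rewrite subr_eq0.
      by have := congr1 (fun f : {ffun _ -> _} => f x) eqPhi; rewrite !ffunE Xx => ->.
    by rewrite -mxrank_eq0 mxrankMfree ?repr_mx_free // mxrank_eq0 nz_row_eq0.
  apply/ffunP => C; have [CD | nCD] := boolP (C \in D).
    apply/eqP; rewrite -subr_eq0; apply/eqP.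
    by have := rcosets_envelop_free Ec phi0 CD; rewrite ffunE.
  have:= contraNN (subsetP sc1 C) nCD; have:= contraNN (subsetP sc2 C) nCD.
  by rewrite !inE !negbK => /eqP-> /eqP->.
have imPhi : Phi @: pffun_on 0 D E \subset pffun_on 0 X [set: 'rV[F]_n].
  apply/subsetP => _ /imsetP[c _ ->]; apply/pffun_onP.
  split => [|v _]; last by rewrite inE.
  by apply/subsetP => x; rewrite !inE ffunE; case: ifP; rewrite ?eqxx.
have := subset_leq_card imPhi.
rewrite (card_in_imset injPhi) !card_pffun_on cardsT card_mx mul1n => le_card.
have : ((#|F| ^ \rank M) ^ #|D| <= (#|F| ^ n) ^ #|X|)%N.
  apply: leq_trans le_card; rewrite leq_exp2r ?indexg_gt0 //.
  exact: card_envelop_ge.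
rewrite -!expnM leq_exp2l //.
have -> : (n * #|X| = \rank M * (#|X| ^ 2))%N.
  by rewrite [LHS](congr1 (muln^~ _) def_n) mulnAC mulnC mulnn.
by rewrite leq_pmul2l.
Qed.

End Homogeneous.

(** * Derived subgroups acting on chief factors *)

Section GroupLemmas.
Variable gT : finGroupType.
Implicit Types G H K V N : {group gT}.

Lemma der_subn G m n : (m <= n)%N -> G^`(n) \subset G^`(m).
Proof.
move=> /subnK <-; elim: (n - m)%N => //= k IHk.
by rewrite addSn (subset_trans (der_subS _ _)).
Qed.

Lemma der_add G m n : G^`(m + n) = (G^`(m)%G)^`(n).
Proof. by rewrite /derived_at /= addnC iterD. Qed.

Lemma card_proper_half G H : H \proper G -> (2 * #|H| <= #|G|)%N.
Proof.
move=> prHG; rewrite -(Lagrange (proper_sub prHG)) mulnC leq_pmul2l ?cardG_gt0 //.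
by rewrite indexg_gt1 proper_subn.
Qed.

Lemma der_trivg_card G d : solvable G -> (#|G| < 2 ^ d.+1)%N -> G^`(d) = 1.
Proof.
elim: d G => [|d IHd] G solG ltG.
  by apply/eqP; rewrite trivg_card_le1.
have [->|ntG] := eqVneq (G : {set gT}) 1.
  by apply/trivgP; apply: (der_sub d.+1 1%G).
rewrite -add1n der_add; apply: IHd; first exact: solvableS (der_sub 1 G) solG.
have /card_proper_half := sol_der1_proper solG (subxx _) ntG.
by move: ltG; rewrite expnS => ltG leG; rewrite -(ltn_pmul2l (ltn0Sn 1)) (leq_ltn_trans leG).
Qed.

Lemma der1_cent_cyclic G V : G \subset 'N(V) -> cyclic V -> G^`(1) \subset 'C(V).
Proof.
move=> nVG cycV; rewrite -(ker_conj_aut V) kerE.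
have nVG1 := subset_trans (der_sub 1 G) nVG.
rewrite -sub_morphim_pre // morphim_der //.
by apply/trivgP/derG1P; apply: abelianS (Aut_conj_aut V G) (Aut_cyclic_abelian cycV).
Qed.

Lemma cent_card2 G V : G \subset 'N(V) -> #|V| = 2 -> G \subset 'C(V).
Proof.
move=> nVG V2; have cycV : cyclic V by rewrite prime_cyclic ?V2.
rewrite -(ker_conj_aut V) kerE -sub_morphim_pre //; apply: subset_trans (Aut_conj_aut V G) _.
by apply/trivgP/eqP; rewrite trivg_card1 card_Aut_cyclic // V2.
Qed.

Lemma der_sub_norm G K d : G \subset 'N(K) -> (G / K)^`(d) = 1 -> G^`(d) \subset K.
Proof.
move=> nKG; rewrite -quotient_der // => /trivgP; apply: contraTT => nsub.
by rewrite quotient_sub1 // (subset_trans (der_sub d G)).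
Qed.

End GroupLemmas.

Lemma abelem_card_exp (gT : finGroupType) (V : {group gT}) q :
  q.-abelem V -> V :!=: 1 -> exists2 j, (0 < j)%N & #|V| = (q ^ j)%N.
Proof.
move=> abelV ntV; have oV := card_pgroup (abelem_pgroup abelV).
exists (logn q #|V|) => //; rewrite lt0n; apply: contraNneq ntV => j0.
by rewrite trivg_card1 oV j0.
Qed.

(** Each derived step of the soluble image of G in GL at least halves its order. *)
Lemma der_card_GL (gT : finGroupType) (G V : {group gT}) q d :
    prime q -> q.-abelem V -> V :!=: 1 -> solvable G -> G \subset 'N(V) ->
  (#|'GL_(logn q #|V|)['F_q]| < 2 ^ d.+1)%N -> G^`(d) \subset 'C(V).
Proof.
move=> pr_q abelV ntV solG nVG; rewrite -(dim_abelemE abelV ntV).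
set rV := abelem_repr abelV ntV nVG => ltGL.
have : G^`(d) \subset rker rV; last by rewrite rker_abelem subsetI => /andP[].
rewrite -(ker_reprGLm rV) kerE -sub_morphim_pre ?der_sub // morphim_der //.
have solf := morphim_sol (reprGL_morphism rV) solG.
rewrite (der_trivg_card solf) //.
by apply: leq_ltn_trans ltGL; apply: subset_leq_card; apply/subsetP => x _; rewrite inE.
Qed.

(* The group type is quantified inside: the induction moves to quotient groups. *)
Definition irr_der_bounded (F : finFieldType) n := forall (gT : finGroupType)
  (G : {group gT}) (rG : mx_representation F G n), solvable G -> mx_irreducible rG ->
  G^`(irr_der_bound #|F| n) \subset rker rG.

Definition chief_der_bounded q j := forall (gT : finGroupType) (G V : {group gT}),
  solvable G -> minnormal V G -> V \subset G -> #|V| = (q ^ j)%N ->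
  G^`(chief_der_bound q j) \subset 'C(V).

(** A minimal normal subgroup of a soluble group is a vector space over a prime field on which G
    acts irreducibly, with kernel its centraliser. *)
Lemma irr_chief_der_bounded q j : prime q -> (0 < j)%N ->
  irr_der_bounded 'F_q j -> chief_der_bounded q j.
Proof.
move=> pr_q j_gt0 bnd gT G V solG minV sVG oV.
have [nVG ntV /is_abelemP[p pr_p abelV]] := minnormal_solvable minV sVG solG.
have {p pr_p} abelV : q.-abelem V.
  have:= abelem_pgroup abelV; rewrite /pgroup oV pnatX (gtn_eqF j_gt0) orbF pnatE //.
  by move/eqP->.
have lV : logn q #|V| = j by rewrite oV pfactorK.
rewrite /chief_der_bound; case: eqP => [j1|_].
  rewrite j1 expn1 in oV; case: eqP => [q2|_] /=.
    by rewrite derg0 cent_card2 // oV q2.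
  by rewrite der1_cent_cyclic // prime_cyclic // oV.
case: eqP => [qj4|_].
  have q2 : q = 2.
    have : q %| 2 ^ 2 by rewrite -[(2 ^ 2)%N]qj4 dvdn_exp.
    by rewrite Euclid_dvdX // andbT dvdn_prime2 // => /eqP.
  have j2 : j = 2 by rewrite -lV oV qj4 q2.
  by apply: der_card_GL pr_q abelV ntV solG nVG _; rewrite lV j2 card_GL_2 card_Fp // q2.
case: eqP => [qj9|_].
  have q3 : q = 3.
    have : q %| 3 ^ 2 by rewrite -[(3 ^ 2)%N]qj9 dvdn_exp.
    by rewrite Euclid_dvdX // andbT dvdn_prime2 // => /eqP.
  have j2 : j = 2 by rewrite -lV oV qj9 q3.
  by apply: der_card_GL pr_q abelV ntV solG nVG _; rewrite lV j2 card_GL_2 card_Fp // q3.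
have dimV : 'dim V = j by rewrite (dim_abelemE abelV ntV).
have := bnd; rewrite -dimV => {}bnd.
have := bnd _ _ (abelem_repr abelV ntV nVG) solG (elimT (abelem_mx_irrP abelV ntV nVG) minV).
by rewrite rker_abelem card_Fp // dimV subsetI => /andP[].
Qed.

(** * Soluble permutation groups, in terms of a point stabiliser H *)

(** In this primitive group a minimal normal V is a self-centralising complement of H. Once a
    derived subgroup centralises V it lies in V, and one more step kills it. The parameter N limits
    the chief factors used, so that an induction can supply [bnd]. *)
Lemma corefree_maximal_der N (gT : finGroupType) (G H : {group gT}) :
    (forall q j, prime q -> (0 < j)%N -> (q ^ j <= N)%N -> chief_der_bounded q j) ->
    solvable G -> maximal H G -> (#|G : H| <= N)%N ->
    (forall K : {group gT}, K <| G -> K \subset H -> K :=: 1) ->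
  G^`(trunc_log 2 (#|G : H| ^ 2)) = 1.
Proof.
move=> bnd solG maxH leN cfH.
have /andP[sHG nsGH] := maxgroupp maxH.
have ntG : G :!=: 1 by apply: contraNneq nsGH => ->; apply: sub1G.
have [V minV sVG] := minnormal_exists ntG (normG G).
have [nVG ntV abV] := minnormal_solvable minV sVG solG.
have /is_abelemP[q pr_q abelV] := abV.
have cVV : abelian V := abelem_abelian abelV.
have nsVH : ~~ (V \subset H).
  by apply: contra ntV => sVH; apply/eqP/cfH; rewrite // /normal sVG.
have defG : V * H = G.
  have nVH := subset_trans sHG nVG.
  rewrite -norm_joinEr //; apply/eqP; have [_ maxG] := maxgroupP maxH.
  apply: contraNT nsVH => neG.
  rewrite -(maxG (V <*> H)%G) ?joing_subl ?joing_subr //.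
  by rewrite properEneq neG join_subG sVG.
(* [K :&: H] is normalised by H and centralised by V, hence normal in [G = V * H]; H being
   core-free, it is trivial. *)
have capH (K : {group gT}) : K \subset 'C(V) -> K <| G -> K :&: H = 1.
  move=> cVK nsKG; apply: (cfH (K :&: H)%G); last exact: subsetIr.
  rewrite /normal subIset ?sHG ?orbT //=.
  suff : V * H \subset 'N(K :&: H) by rewrite defG.
  apply: mul_subG.
    by rewrite cents_norm // centsC subIset ?cVK.
  by rewrite normsI ?normG // (subset_trans sHG) ?normal_norm.
have tiVH : V :&: H = 1 by apply: capH => //; rewrite /normal sVG.
have tiCH : 'C_G(V) :&: H = 1.
  apply: (capH 'C_G(V)%G); first exact: subsetIr.
  by rewrite /normal subsetIl normsI ?normG ?norms_cent.
have oV : #|V| = #|G : H|.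
  by rewrite -divgS // -defG TI_cardMg // mulnK.
have defC : 'C_G(V) = V.
  have sVC : V \subset 'C_G(V) by rewrite subsetI sVG.
  have := group_modl H sVC.
  by rewrite [H :&: _]setIC tiCH mulg1 defG (setIidPr (subsetIl _ _)).
have [j j_gt0 oVq] := abelem_card_exp abelV ntV.
have := bnd q j pr_q j_gt0; rewrite -oVq oV => /(_ leN _ G V solG minV sVG oVq) cVG.
have le_d : (chief_der_bound q j < trunc_log 2 (#|G : H| ^ 2))%N.
  by rewrite trunc_log_max // -oV oVq chief_der_bound_primitive.
apply/trivgP; apply: subset_trans (der_subn G le_d) _.
have sderV : G^`(chief_der_bound q j) \subset V by rewrite -defC subsetI der_sub.
by rewrite dergSn (subset_trans (commgSS sderV sderV)) //; apply/trivgP/commG1P.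
Qed.

(** A maximal M strictly above H splits the index into two factors, whose bounds add up. If H itself
    is maximal, its core is factored out to reach the primitive case. *)
Lemma index_der_bound N (gT : finGroupType) (G H : {group gT}) :
    (forall q j, prime q -> (0 < j)%N -> (q ^ j <= N)%N -> chief_der_bounded q j) ->
    solvable G -> H \subset G -> (#|G : H| <= N)%N ->
  G^`(trunc_log 2 (#|G : H| ^ 2)) \subset H.
Proof.
move=> bnd; have [k] := ubnP #|G : H|.
elim: k G H => // k IHk G H /ltnSE-lek solG sHG leN.
have [eqGH|[M maxM sHM]] := maximal_exists sHG.
  by rewrite eqGH (subset_trans (der_sub _ _)).
have /andP[sMG nsGM] := maxgroupp maxM.
have gtM : (1 < #|G : M|)%N by rewrite indexg_gt1.
have iM : (#|G : M| * #|M : H|)%N = #|G : H| by rewrite Lagrange_index.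
have [sMH|nsMH] := boolP (M \subset H); last first.
  have gtH : (1 < #|M : H|)%N by rewrite indexg_gt1.
  have ltM : (#|G : M| < #|G : H|)%N by rewrite -iM -[X in (X < _)%N]muln1 ltn_pmul2l // ltnW.
  have ltH : (#|M : H| < #|G : H|)%N by rewrite -iM -[X in (X < _)%N]mul1n ltn_pmul2r // ltnW.
  have leM := IHk G M (leq_trans ltM lek) solG sMG (leq_trans (ltnW ltM) leN).
  have leH := IHk M H (leq_trans ltH lek) (solvableS sMG solG) sHM (leq_trans (ltnW ltH) leN).
  have := @trunc_log2_sqrM #|G : M| #|M : H| 1 (ltnW gtM) (ltnW gtH) isT.
  rewrite !mul1n iM => le_d; apply: subset_trans (der_subn G le_d) _.
  by rewrite der_add; apply: subset_trans leH; apply: dergS.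
have eqHM : H :=: M by apply/eqP; rewrite eqEsubset sHM.
have maxH : maximal H G by rewrite /maximal eqHM.
have nsCG : gcore H G <| G := gcore_normal sHG.
have sCH : gcore H G \subset H := gcore_sub H G.
have nCG := normal_norm nsCG.
have nsCH : gcore H G <| H := normalS sCH sHG nsCG.
rewrite -(quotientSGK _ sCH) ?(subset_trans (der_sub _ _)) // quotient_der //.
rewrite -(index_quotient_eq _ sHG nCG) ?subIset ?sCH ?orbT //.
rewrite (corefree_maximal_der bnd) ?sub1G ?quotient_sol //.
- by rewrite quotient_maximal.
- by rewrite index_quotient_eq ?subIset ?sCH ?orbT.
move=> K nsKG sKH; rewrite -(cosetpreK K) quotientS1 //.
apply: gcore_max; first by rewrite sub_cosetpre_quo.
by rewrite normal_norm // -[X in _ <| X](quotientGK nsCG) cosetpre_normal.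
Qed.

(** * Clifford theory and the bound for irreducible groups *)

Lemma Clifford_der (F : fieldType) (gT : finGroupType) (G H : {group gT}) n
    (rG : mx_representation F G n) (nsHG : H <| G)
    (sH : socleType (subg_repr rG (normal_sub nsHG))) (W : sH) a b :
    mx_irreducible rG -> G^`(a) \subset rstabs rG W ->
    (rstabs rG W)^`(b) \subset rstab rG W ->
  G^`(a + b) \subset rker rG.
Proof.
move=> irrG sGa sSb.
have sGW : G^`(a + b) \subset rstab rG W.
  by rewrite der_add (subset_trans _ sSb) // (dergS b (G := G^`(a)) (H := rstabs_group rG W)).
apply/subsetP => x Dx; have Gx := subsetP (der_sub _ G) x Dx.
apply/rkerP; split=> //.
apply/eqP; rewrite -subr_eq0 -submx0 -[(_ - _)%R]mul1mx.
rewrite -[X in (X *m _)%R](Clifford_Socle1 irrG sH) sumsmxMr.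
apply/sumsmx_subP => W1 _.
have := atransPin (subxx G) (Clifford_atrans irrG sH) (in_setT W).
move/setP/(_ W1); rewrite in_setT => /orbitP[y Gy <-].
rewrite (eqmxMr _ (val_Clifford_act W Gy)) submx0 mulmxBr mulmx1 subr_eq0 -mulmxA -repr_mxM //.
have Dxy : x ^ y^-1 \in G^`(a + b).
  by rewrite memJ_norm // groupV (subsetP (normal_norm (der_normal _ G))).
have Gxy := subsetP (der_sub _ G) _ Dxy.
by rewrite conjgCV repr_mxM // mulmxA (rstab_act (subsetP sGW _ Dxy)).
Qed.

Lemma homogeneous_der (F : finFieldType) (gT : finGroupType) (G A : {group gT}) n
    (rG : mx_representation F G n) (nsAG : A <| G)
    (rA := subg_repr rG (normal_sub nsAG)) (M : 'M_n) :
    solvable G -> mx_irreducible rG -> mx_faithful rG ->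
    [max A | A <| G & abelian A] ->
    (forall M1 M2, mxsimple rA M1 -> mxsimple rA M2 -> mx_iso rA M1 M2) ->
    mxsimple rA M ->
    (forall q j, prime q -> (0 < j)%N -> (q ^ j <= (n %/ \rank M) ^ 2)%N ->
       chief_der_bounded q j) ->
  G^`((trunc_log 2 (4 * (n %/ \rank M) ^ 2)).+2) = 1.
Proof.
move=> solG irrG ffulG maxA homA simM bnd.
have [/andP[_ cAA] maxA'] := maxgroupP maxA.
have nAG := normal_norm nsAG; have sAG := normal_sub nsAG.
set t := (n %/ _)%N.
have t_gt0 : (0 < t)%N.
  rewrite divn_gt0 ?rank_leq_row // lt0n mxrank_eq0.
  by have [] := simM.
set r := trunc_log 2 _.
have r_gt0 : (0 < r)%N.
  by rewrite trunc_log_gt0 /=; have : (0 < t ^ 2)%N by [rewrite expn_gt0 t_gt0]; lia.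
(* A acts faithfully on M: if a fixes M pointwise, [rG a - 1] is a singular element of the field
   F[A], hence 0. *)
have cycA : cyclic A.
  have irrM : mx_irreducible (submod_repr (mxsimple_module simM)) by apply/submod_mx_irr.
  apply: (mx_faithful_irr_abelian_cyclic _ irrM cAA).
  apply/subsetP => a; rewrite rker_submod => /setIdP[Aa /eqP fixa].
  have Ga := subsetP sAG a Aa.
  suff /eqP : (rG a - 1%:M = 0)%R.
    by rewrite subr_eq0 => /eqP ra1; apply: (subsetP ffulG); rewrite inE Ga mul1mx ra1 /=.
  apply/eqP; apply: contraTT isT => nz.
  have : (rG a - 1%:M)%R \in unitmx.
    apply: (homogeneous_envelop_unit cAA irrG homA _ nz).
    by rewrite linearB addmx_sub ?eqmx_opp ?envelop_mx1 // (envelop_mx_id rA).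
  move/mulmxK/(_ M) => eqM; have [_ nzM _] := simM; case/eqP: nzM; rewrite -eqM.
  by rewrite mulmxBr mulmx1 [(M *m rG a)%R]fixa subrr mul0mx.
have cAG1 : G^`(1) \subset 'C(A) := der1_cent_cyclic nAG cycA.
have cAK : G^`(r) \subset 'C(A) := subset_trans (der_subn G r_gt0) cAG1.
suff sKA : G^`(r.+1) \subset A.
  rewrite dergSn; apply/trivgP; apply: subset_trans (commgSS sKA sKA) _.
  by apply/trivgP/commG1P.
apply: contraT => nsKA.
pose U := (A <*> G^`(r.+1))%G.
have nsUG : U <| G by apply: normalY => //; apply: der_normal.
have sAU : A \subset U := joing_subl _ _.
have cAU : U \subset 'C(A).
  by rewrite join_subG -/(abelian A) cAA (subset_trans (der_subS _ _)).
have ntU : (U / A)%G :!=: 1.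
  have nAU := subset_trans (normal_sub nsUG) nAG.
  apply: contra nsKA; rewrite -subG1 quotient_sub1 // => sUA.
  exact: subset_trans (joing_subr _ _) sUA.
have nUA : G / A \subset 'N(U / A) by rewrite quotient_norms ?normal_norm.
have [V minV sVU] := minnormal_exists ntU nUA.
have sVG : V \subset G / A := subset_trans sVU (quotientS A (normal_sub nsUG)).
have [nVG ntV abV] := minnormal_solvable minV sVG (quotient_sol A solG).
have /is_abelemP[q pr_q abelV] := abV.
pose B := (coset A @*^-1 V)%G.
have defV : B / A = V := cosetpreK V.
have sAB : A \subset B := sub_cosetpre V.
have sBU : B \subset U by rewrite sub_cosetpre_quo ?(normalS sAU (normal_sub nsUG)).
have nsBG : B <| G.
  rewrite -[X in _ <| X](quotientGK nsAG) cosetpre_normal /normal sVG.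
  exact: nVG.
have sBG := normal_sub nsBG.
have cAB : B \subset 'C(A) := subset_trans sBU cAU.
have derB : B^`(1) \subset A.
  by rewrite der1_min ?(subset_trans sBG) // defV (abelem_abelian abelV).
(* The centre of B is abelian, normal in G and contains A, so it equals A by maximality. *)
have centB : 'C_B(B) \subset A.
  have -> : A :=: 'Z(B)%G.
    apply/esym; apply: maxA'.
      by rewrite (char_normal_trans (center_char B) nsBG) center_abelian.
    by rewrite subsetI sAB centsC.
  by [].
have le_t := index_homogeneous_le cAA irrG homA ffulG sAB sBG cAB derB centB simM.
have oV : #|V| = #|B : A| by rewrite -defV card_quotient // (subset_trans sBG).
have [j j_gt0 oVq] := abelem_card_exp abelV ntV.
have leqj : (q ^ j <= t ^ 2)%N by rewrite -oVq oV.
have cV := bnd q j pr_q j_gt0 leqj _ _ V (quotient_sol A solG) minV sVG oVq.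
have le_r : (chief_der_bound q j <= r)%N.
  by rewrite trunc_log_max // chief_der_bound_homogeneous.
have sKG := der_sub r G.
have sKBA : [~: G^`(r), B] \subset A.
  rewrite -quotient_cents2 ?(subset_trans _ nAG) // quotient_der // defV.
  exact: subset_trans (der_subn _ le_r) cV.
(* Three subgroup lemma: [[~: G^](r), B][lies in A, which]G^[(r)] centralises. *)
have cBK' : G^`(r.+1) \subset 'C(B).
  apply/commG1P; rewrite dergSn; apply: three_subgroup.
    by apply/commG1P; rewrite (subset_trans sKBA) // centsC.
  by apply/commG1P; rewrite commGC (subset_trans sKBA) // centsC.
have cBU : U \subset 'C(B) by rewrite join_subG cBK' centsC cAB.
have sBA : B \subset A.
  by apply: subset_trans centB; rewrite subsetI subxx (subset_trans sBU).
by case/eqP: ntV; rewrite -defV quotientS1.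
Qed.

Lemma irr_const_gt0 q : (0 < irr_const q)%N.
Proof. by rewrite /irr_const; case: ifP. Qed.

(* The measure decreases although the dimension need not: for q = 2 and |F| > 2
   the chief factor may have dimension n over the field with two elements. *)
Lemma irr_measure_homogeneous q j t e n p : prime q -> (0 < t)%N ->
  n = (t * e)%N -> (0 < e)%N -> (p == 2 -> 1 < e)%N -> (q ^ j <= t ^ 2)%N ->
  (2 * j + (q != 2) < 2 * n + (p != 2))%N.
Proof.
move=> pr_q t_gt0 def_n e_gt0 e_p le_t.
(* These give j <= t for q = 2 and j < t for odd q. *)
have lt2 := sqr_lt_exp2S t; have lt3 := sqr_lt_exp3 t.
have [q2|qn2] /= := eqVneq q 2.
  rewrite q2 in le_t; have := leq_ltn_trans le_t lt2; rewrite ltn_exp2l // ltnS => lejt.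
  by case: (p == 2) e_p => [/(_ isT)|_] /= => [e_gt1|]; nia.
have q_ge3 : (3 <= q)%N by have := prime_gt1 pr_q; lia.
have : (j < t)%N.
  case: (posnP j) => [->//|j_gt0].
  rewrite -(ltn_exp2l _ _ (isT : 1 < 3)%N) (leq_ltn_trans _ lt3) //.
  by rewrite (leq_trans _ le_t) // leq_exp2r.
by case: (p == 2) e_p => [/(_ isT)|_] /= => [e_gt1|]; nia.
Qed.

Lemma rstabs_index (F : fieldType) (gT : finGroupType) (G H : {group gT}) n
    (rG : mx_representation F G n) (nsHG : H <| G)
    (sH : socleType (subg_repr rG (normal_sub nsHG))) (W : sH) :
  mx_irreducible rG -> #|G : rstabs rG W| = #|sH|.
Proof.
move=> irrG; have := @card_orbit_in _ _ _ (Clifford_action sH) G W (subxx G).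
rewrite (atransPin (subxx G) (Clifford_atrans irrG sH) (in_setT W)) cardsT => ->.
by rewrite Clifford_astab1 (setIidPr (rstabs_sub rG W)).
Qed.

Lemma socle_iso1 (F : fieldType) (gT : finGroupType) (G : {group gT}) n
    (rG : mx_representation F G n) (sG : socleType rG) :
  (#|sG| <= 1)%N -> forall M1 M2, mxsimple rG M1 -> mxsimple rG M2 -> mx_iso rG M1 M2.
Proof.
move=> le1 M1 M2 simM1 simM2; apply/component_mx_isoP => //.
have /card_le1_eqP eqW := le1.
pose W M (simM : mxsimple rG M) := PackSocle (component_socle sG simM).
have := congr1 (fun W : sG => W : 'M_n) (eqW (W _ simM1) (W _ simM2) isT isT).
by rewrite !PackSocleK => ->.
Qed.

(** The only nonzero scalar is 1, so each [rG a - 1] kills M; being singular in the field F[A], it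
    is 0. *)
Lemma rank1_F2_trivg (F : finFieldType) (gT : finGroupType) (G A : {group gT}) n
    (rG : mx_representation F G n) (nsAG : A <| G)
    (rA := subg_repr rG (normal_sub nsAG)) (M : 'M_n) :
    abelian A -> mx_irreducible rG -> mx_faithful rG -> #|F| = 2 ->
    (forall M1 M2, mxsimple rA M1 -> mxsimple rA M2 -> mx_iso rA M1 M2) ->
    mxsimple rA M -> \rank M = 1%N ->
  A :=: 1.
Proof.
move=> cAA irrG ffulG F2 homA simM rM1; have [modM nzM _] := simM.
have [u [c defM uc]] := mxmodule_eigenvector modM rM1.
have nz_u : u != 0%R by rewrite -mxrank_eq0 -defM mxrank_eq0.
apply/trivgP/subsetP => a Aa; have Ga := subsetP (normal_sub nsAG) a Aa.
have c1 : c a = 1%R.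
  apply: contraTeq isT => nc1.
  have nc0 : c a != 0%R.
    apply: contraNneq nz_u => c0; have := uc a Aa; rewrite c0 scale0r.
    by move/(canRL (repr_mxK rA Aa)); rewrite mul0mx => ->.
  have : uniq [:: 0; 1; c a]%R.
    by rewrite /= !inE negb_or eq_sym oner_eq0 eq_sym nc0 eq_sym nc1.
  by move/card_uniqP => /= c3; have := max_card (mem [:: 0; 1; c a]%R); rewrite c3 F2.
have : (rG a - 1%:M)%R \notin unitmx.
  apply: contra nz_u => /mulmxK/(_ u) <-.
  by rewrite mulmxBr mulmx1 [(u *m rG a)%R](uc a Aa) c1 scale1r subrr mul0mx.
apply: contraNT => na1; apply: (homogeneous_envelop_unit cAA irrG homA).
  by rewrite linearB addmx_sub ?eqmx_opp ?envelop_mx1 // (envelop_mx_id rA).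
rewrite subr_eq0; apply: contra na1 => /eqP ra1.
by apply: (subsetP ffulG); rewrite inE Ga mul1mx ra1 /=.
Qed.

(** F varies in the induction, because the chief factors met on the way are spaces over prime fields
    unrelated to F. *)
Theorem irr_der_bounded_all (F : finFieldType) n : irr_der_bounded F n.
Proof.
have [k] := ubnP (2 * n + (#|F| != 2))%N.
elim: k F n => // k IHk F n /ltnSE-lek.
suff bndF : forall (gT : finGroupType) (G : {group gT}) (rG : mx_representation F G n),
    solvable G -> mx_irreducible rG -> mx_faithful rG -> G^`(irr_der_bound #|F| n) = 1.
  move=> gT G rG solG irrG.
  apply: (@der_sub_norm _ _ (rker_group rG)); first exact: rker_norm.
  apply: (bndF _ _ (kquo_repr rG)); first exact: quotient_sol.
    by apply/quo_mx_irr.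
  exact: kquo_mx_faithful.
move=> gT G rG solG irrG ffulG.
have chief_bnd q j : prime q -> (0 < j)%N -> (2 * j + (q != 2) < 2 * n + (#|F| != 2))%N ->
    chief_der_bounded q j.
  move=> pr_q j_gt0 ltj; apply: irr_chief_der_bounded => //.
  by apply: IHk; rewrite card_Fp // (leq_trans ltj).
have [A maxA _] : {A : {group gT} | [max A | A <| G & abelian A] & 1%G \subset A}.
  by apply: (@maxgroup_exists _ (fun A => (A <| G) && abelian A)); rewrite normal1 abelian1.
have /andP[nsAG cAA] := maxgroupp maxA.
pose rA := subg_repr rG (normal_sub nsAG).
apply/eqP; apply: (socle_exists rA) => sH.
have [W _ _] := imsetP (Clifford_atrans irrG sH).
have rankW := Clifford_rank_components irrG W.
have n_gt0 : (0 < n)%N by have [] := (mx_irrP _).1 irrG.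
have [le1|gt1] := leqP #|sH| 1.
  have homA := socle_iso1 le1.
  have simM := socle_simple W; set M := socle_base W in simM.
  have [X [sXG defX def_n]] := Clifford_basis_rank irrG simM.
  set e := \rank M in def_n.
  have e_gt0 : (0 < e)%N by rewrite lt0n mxrank_eq0; have [] := simM.
  have t_gt0 : (0 < #|X|)%N by rewrite lt0n; apply: contraTneq n_gt0 => X0; rewrite def_n X0.
  have [p2e1|p2e] := boolP ((#|F| == 2) && (e == 1)%N).
    have /andP[/eqP F2 /eqP e1] := p2e1.
    have A1 : A :=: 1 by exact: rank1_F2_trivg cAA irrG ffulG F2 homA simM e1.
    (* A minimal normal subgroup of G would be abelian, hence equal to A = 1 by maximality. *)
    have -> : G :=: 1; last by rewrite -subG1 (der_sub _ 1%G).
    apply: contraTeq isT => ntG.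
    have [V minV sVG] := minnormal_exists ntG (normG G).
    have [nVG ntV abV] := minnormal_solvable minV sVG solG.
    have [_ maxA'] := maxgroupP maxA.
    case/eqP: ntV; rewrite -A1; apply: maxA'; last by rewrite A1 sub1G.
    by rewrite /normal sVG nVG; have /is_abelemP[q _ /abelem_abelian] := abV.
  have {p2e} e_p : #|F| == 2 -> (1 < e)%N.
    by move: p2e => /[swap] ->; rewrite ltn_neqAle e_gt0 andbT eq_sym.
  have def_t : (n %/ e)%N = #|X| by rewrite [X in (X %/ _)%N]def_n mulnK.
  have := homogeneous_der solG irrG ffulG maxA homA simM; rewrite -/e def_t => der1.
  rewrite -subG1 -der1; last first.
    move=> q j pr_q j_gt0 le_t; apply: chief_bnd => //.
    exact: irr_measure_homogeneous pr_q t_gt0 def_n e_gt0 e_p le_t.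
  (* The two extra derived steps turn 4 t ^ 2 into 16 t ^ 2. For #|F| = 2 the factor 4 missing from
     [irr_const] comes from e ^ 2 with e > 1. *)
  apply: der_subn; rewrite trunc_log_max // -[X in (2 ^ X)%N]addn2 expnD.
  have le4 : (2 ^ trunc_log 2 (4 * #|X| ^ 2) <= 4 * #|X| ^ 2)%N.
    by rewrite trunc_logP // muln_gt0 expn_gt0 t_gt0.
  apply: leq_trans (leq_mul le4 (leqnn (2 ^ 2))) _.
  rewrite [X in (_ <= _ * X ^ 2)%N]def_n expnMn mulnCA [(4 * _)%N]mulnC -mulnA leq_mul2l.
  apply/orP; right; rewrite /irr_const; case: eqP e_p => [_ /(_ isT)|_ _] => [e_gt1|].
    by rewrite leq_mul2l /= leq_exp2r.
  by rewrite leq_pmulr // expn_gt0 e_gt0.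
have W_gt0 : (0 < \rank W)%N by rewrite lt0n mxrank_eq0 nz_socle.
have oS := rstabs_index W irrG.
have sSG := rstabs_sub rG W.
have ltWn : (\rank W < n)%N.
  by rewrite -[X in (_ < X)%N]rankW -[X in (X < _)%N]mul1n ltn_pmul2r.
have der_W : (rstabs_group rG W)^`(irr_der_bound #|F| (\rank W)) \subset rstab rG W.
  have [modW _ _] := Clifford_rstabs_simple irrG W.
  have := IHk F (\rank W) _ _ _ (submod_repr modW).
  rewrite rker_submod rstab_subg => bndW.
  apply: subset_trans (subsetIr _ _).
  apply: bndW; last by apply/submod_mx_irr/Clifford_rstabs_simple.
    by apply: leq_trans lek; rewrite ltn_add2r ltn_mul2l.
  exact: solvableS sSG solG.
(* Chief factors of order at most n have j < n, so the induction covers them over any prime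
   field. *)
have der_G : G^`(trunc_log 2 (#|sH| ^ 2)) \subset rstabs_group rG W.
  rewrite -oS; apply: (@index_der_bound n) => // [q j pr_q j_gt0 le_n|].
    apply: chief_bnd => //; have : (j < n)%N.
      apply: leq_trans le_n; apply: (leq_trans (ltn_expl j (ltnSn 1))).
      by rewrite leq_exp2r // prime_gt1.
    case: (q != 2); lia.
  by rewrite oS -[X in (_ <= X)%N]rankW leq_pmulr.
rewrite -subG1; apply: subset_trans ffulG.
have := Clifford_der irrG der_G der_W; apply: subset_trans; apply: der_subn.
have := trunc_log2_sqrM (ltnW gt1) W_gt0 (irr_const_gt0 #|F|).
by rewrite rankW.
Qed.

(** * Derived length and group order *)

Lemma chief_der_bound_le q j : (0 < j)%N -> (2 ^ chief_der_bound q j <= 16 * j ^ 2)%N.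
Proof.
move=> j_gt0; rewrite /chief_der_bound; case: eqP => [->|j1]; first by case: (q != 2).
have j2 : (4 <= j ^ 2)%N by rewrite (@leq_exp2r 2 j 2) //; lia.
case: eqP => [_|_]; first lia.
case: eqP => [_|_]; first by rewrite (leq_trans (_ : _ <= 16 * 4)%N) // leq_mul2l.
apply: leq_trans (irr_der_boundP q j_gt0) _.
by rewrite /irr_const; case: ifP => // _; rewrite leq_mul2r orbT.
Qed.

Lemma three_subgroup_norm (gT : finGroupType) (G H K N : {group gT}) :
    G \subset 'N(N) -> H \subset 'N(N) -> K \subset 'N(N) ->
    [~: G, H, K] \subset N -> [~: H, K, G] \subset N -> [~: K, G, H] \subset N.
Proof.
move=> nG nH nK sGHK sHKG.
have nR (A B : {set gT}) : A \subset 'N(N) -> B \subset 'N(N) -> [~: A, B] \subset 'N(N).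
  exact: comm_subG.
rewrite -quotient_sub1 ?nR //; apply/trivgP; rewrite /= !quotientR ?nR //.
by apply: three_subgroup; rewrite -!quotientR ?nR // quotientS1.
Qed.

(** Induction on j by the three subgroup lemma; the indices are shifted because the series starts
    with ['L_1(G) = G]. *)
Lemma lcn_commg (gT : finGroupType) (G : {group gT}) i j :
  [~: 'L_i.+1(G), 'L_j.+1(G)] \subset 'L_(i + j).+2(G).
Proof.
elim: j i => [|j IHj] i; first by rewrite addn0 lcn1 -lcnSn.
have nL k : G \subset 'N('L_k(G)) by apply: lcn_norm.
have nLL k l : 'L_k(G) \subset 'N('L_l(G)) by apply: subset_trans (lcn_sub k G) (nL l).
rewrite commGC [in X in [~: X, _]]lcnSn.
apply: (@three_subgroup_norm _ G 'L_i.+1(G)%G 'L_j.+1(G)%G 'L_(i + j.+1).+2(G)%G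
  (nL _) (nLL _ _) (nLL _ _)).
  by rewrite (commGC G) -lcnSn addnS -addSn; apply: IHj.
by rewrite addnS; apply: commSg (IHj i).
Qed.

Lemma der_sub_lcn (gT : finGroupType) (G : {group gT}) n : G^`(n) \subset 'L_(2 ^ n)(G).
Proof.
elim: n => [|n IHn]; first by rewrite lcn1.
rewrite dergSn; apply: subset_trans (commgSS IHn IHn) _.
rewrite expnS mul2n -addnn; move: (2 ^ n)%N (expn_gt0 2 n) => [|m] //= _.
by rewrite addSn addnS; apply: lcn_commg.
Qed.

(** The lower central series of K cannot stall at a nontrivial term, so the order at least halves at
    each step. *)
Lemma lcn_trivg_card (gT : finGroupType) (G K : {group gT}) n : K <| G ->
    (forall M : {group gT}, M <| G -> M :!=: 1 -> ~~ (M \subset [~: M, K])) ->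
    (#|K| < 2 ^ n.+1)%N -> 'L_n.+1(K) = 1.
Proof.
move=> nsKG propK ltK.
suff [//|] : 'L_n.+1(K) = 1 \/ (2 ^ n * #|'L_n.+1(K)| <= #|K|)%N.
  move/leq_ltn_trans/(_ ltK); rewrite expnSr ltn_pmul2l ?expn_gt0 // => lt2.
  by apply/eqP; rewrite trivg_card_le1.
elim: n {ltK} => [|n IHn]; first by right; rewrite mul1n lcn1.
have [L1|ntL] := eqVneq ('L_n.+1(K)) 1.
  by left; rewrite lcnSn L1 comm1G.
case: IHn => [L1|leK]; first by rewrite L1 eqxx in ntL.
right; apply: leq_trans leK; rewrite expnSr -mulnA leq_mul2l; apply/orP; right.
apply: card_proper_half; rewrite properE lcn_subS /=.
apply: (propK 'L_n.+1(K)%G) => //.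
exact: char_normal_trans (lcn_char _ _) nsKG.
Qed.

(** For P maximal among the G-invariant proper subgroups of M, [M / P] is a chief factor of rank at
    most N. The derived subgroup centralises it, which puts the commutator inside P. *)
Lemma chief_commg_proper (gT : finGroupType) (G M : {group gT}) N :
    solvable G -> (#|G| < 2 ^ N.+1)%N -> M <| G -> M :!=: 1 ->
  ~~ (M \subset [~: M, G^`(trunc_log 2 (16 * N ^ 2))]).
Proof.
move=> solG ltG /andP[sMG nMG] ntM.
set a := trunc_log 2 _.
have [P maxP _] : {P : {group gT} | maxnormal P M G & 1%G \subset P}.
  apply: (@maxgroup_exists _ (fun P => (P \proper M) && (G \subset 'N(P)))).
  by rewrite proper1G ntM norms1.
have /andP[prPM nPG] := maxgroupp maxP.
have nPM := subset_trans sMG nPG.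
have minV := maxnormal_minnormal nPM nMG maxP.
have sVG : M / P \subset G / P := quotientS P sMG.
have solGP := quotient_sol P solG.
have [nVG ntV /is_abelemP[q pr_q abelV]] := minnormal_solvable minV sVG solGP.
have [j j_gt0 oVq] := abelem_card_exp abelV ntV.
have lejN : (j <= N)%N.
  rewrite -ltnS -(ltn_exp2l _ _ (ltnSn 1)) (leq_ltn_trans _ ltG) //.
  apply: (@leq_trans (q ^ j)); first by rewrite leq_exp2r // prime_gt1.
  by rewrite -oVq (leq_trans (leq_quotient _ _)) // subset_leq_card.
have bnd := irr_chief_der_bounded pr_q j_gt0 (@irr_der_bounded_all 'F_q j).
have cV := bnd _ (G / P)%G (M / P)%G solGP minV sVG oVq.
have le_a : (chief_der_bound q j <= a)%N.
  rewrite trunc_log_max // (leq_trans (chief_der_bound_le q j_gt0)) //.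
  by rewrite leq_mul2l leq_exp2r.
have sMP : [~: M, G^`(a)] \subset P.
  rewrite commGC -quotient_cents2 ?(subset_trans (der_sub _ _)) // quotient_der //.
  exact: subset_trans (der_subn _ le_a) cV.
by apply: contraL prPM => sM; rewrite properE negb_and negbK (subset_trans sM) ?orbT.
Qed.

Theorem solvable_der_card (gT : finGroupType) (G : {group gT}) (N := trunc_log 2 #|G|) :
  solvable G -> G^`(trunc_log 2 (16 * N ^ 2) + (trunc_log 2 N).+1) = 1.
Proof.
move=> solG; have ltG : (#|G| < 2 ^ N.+1)%N by apply: trunc_log_ltn.
rewrite der_add; set K := G^`(_)%G.
have ltK : (#|K| < 2 ^ N.+1)%N by rewrite (leq_ltn_trans _ ltG) // subset_leq_card ?der_sub.
have L1 : 'L_N.+1(K) = 1.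
  apply: lcn_trivg_card (der_normal _ G) _ ltK => M.
  exact: chief_commg_proper.
apply/trivgP; rewrite -L1; apply: subset_trans (der_sub_lcn _ _) _.
(* N + 1 <= 2 ^ k for k = [(trunc_log 2 N).+1]. *)
by apply: lcn_sub_leq; apply: trunc_log_ltn.
Qed.

(** * Word length and diameter *)

(** Adjoining 1 makes the k-th power collect the words of length at most k, not exactly k. *)
Definition word_ball (gT : finGroupType) (X : {set gT}) k : {set gT} :=
  (1 |: (X :|: X^-1)) ^+ k.

Section Ball.
Variables (gT : finGroupType) (X : {set gT}).
Implicit Types (g h : gT) (Y S : {set gT}).
Local Notation word_ball := (word_ball X).

Lemma mem_word_ball1 g : g \in X -> g \in word_ball 1.
Proof. by rewrite /word_ball expg1 !inE => ->; rewrite orbT. Qed.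

Lemma word_ballM a b g h :
  g \in word_ball a -> h \in word_ball b -> g * h \in word_ball (a + b).
Proof. by rewrite /word_ball expgD; apply: mem_mulg. Qed.

Lemma word_ball_1 a : 1 \in word_ball a.
Proof.
elim: a => [|a IHa]; first by rewrite /word_ball expg0 set11.
by rewrite -(mulg1 1) -addn1 (word_ballM IHa) // /word_ball expg1 setU11.
Qed.

Lemma word_ball_sub a b : (a <= b)%N -> word_ball a \subset word_ball b.
Proof.
move=> /subnK <-; apply/subsetP => g ga.
by rewrite -[g]mul1g word_ballM ?word_ball_1.
Qed.

Lemma word_ballV a g : g \in word_ball a -> g^-1 \in word_ball a.
Proof.
elim: a g => [|a IHa] g; first by rewrite /word_ball expg0 !inE => /eqP->; rewrite invg1.
rewrite {1}/word_ball expgSr => /mulsgP[h x ha xX ->]; rewrite invMg -addn1 addnC.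
apply: word_ballM (IHa h ha); rewrite /word_ball expg1; move: xX.
by rewrite !inE invgK eq_invg1 => /or3P[] ->; rewrite ?orbT.
Qed.

Lemma word_ballX a n g : g \in word_ball a -> g ^+ n \in word_ball (n * a).
Proof.
move=> ga; elim: n => [|n IHn]; first by rewrite expg0 word_ball_1.
by rewrite expgS mulSn word_ballM.
Qed.

Lemma word_ball_conj a g x : g \in word_ball a -> x \in X -> g ^ x \in word_ball (a + 2).
Proof.
move=> ga xX; rewrite conjgE (_ : a + 2 = 1 + (a + 1))%N; last by lia.
by rewrite !word_ballM ?word_ballV ?mem_word_ball1.
Qed.

Lemma word_ball_commg a g h :
  g \in word_ball a -> h \in word_ball a -> [~ g, h] \in word_ball (4 * a).
Proof.
move=> ga ha; rewrite commgEl conjgE (_ : 4 * a = a + (a + (a + a)))%N; last by lia.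
by rewrite !word_ballM ?word_ballV.
Qed.

(** D is the normal closure of S. Each round adjoins the conjugates by X, at cost 2 in length, and
    at least doubles the generated subgroup until it is normal. *)
Lemma word_ball_gen_normal (S : {set gT}) (D : {group gT}) c m :
    S \subset word_ball c -> S \subset D -> <<X>> \subset 'N(D) ->
    (forall K : {group gT}, <<X>> \subset 'N(K) -> S \subset K -> D \subset K) ->
    (#|D| < 2 ^ m.+1)%N ->
  exists2 Y : {set gT}, <<Y>> = D & Y \subset word_ball (c + 2 * m).
Proof.
move=> Sc sSD nDX minD ltD.
suff [Y [Yb sSY sYD [nY | leY]]] : exists Y : {set gT},
  [/\ Y \subset word_ball (c + 2 * m), S \subset <<Y>>, Y \subset D &
      <<X>> \subset 'N(<<Y>>) \/ (2 ^ m.+1 <= #|<<Y>>|)%N].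
- exists Y => //; apply/eqP; rewrite eqEsubset gen_subG sYD /=.
  exact: (minD <<Y>>%G).
- have : (#|<<Y>>| <= #|D|)%N by rewrite subset_leq_card // gen_subG.
  by move/(leq_trans leY); rewrite leqNgt ltD.
elim: m {ltD} => [|m [Y [Yb sSY sYD alt]]].
  exists S; rewrite muln0 addn0; split=> //; first exact: subset_gen.
  (* A subgroup that is not normalised is nontrivial; this factor 2 saves one round. *)
  have [nS|nnS] := boolP (<<X>> \subset 'N(<<S>>)); [by left | right].
  by rewrite expn1 cardG_gt1; apply: contraNneq nnS => ->; apply: norms1.
have [nY|nnY] := boolP (<<X>> \subset 'N(<<Y>>)).
  exists Y; split=> //; last by left.
  by apply: subset_trans Yb (word_ball_sub _); rewrite leq_add2l leq_mul2l leqnSn.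
case: alt => [nY|leY]; first by rewrite nY in nnY.
pose Z := Y :|: [set y ^ x | y in Y, x in X].
have sYZ : <<Y>> \subset <<Z>> by rewrite genS // subsetUl.
exists Z; split.
- rewrite subUset (subset_trans Yb) ?word_ball_sub ?leq_add2l ?leq_mul2l ?leqnSn //=.
  apply/subsetP => _ /imset2P[y x Yy Xx ->].
  by rewrite mulnS addnA addnAC word_ball_conj // (subsetP Yb).
- exact: subset_trans sSY sYZ.
- rewrite subUset sYD; apply/subsetP => _ /imset2P[y x Yy Xx ->].
  by rewrite memJ_norm ?(subsetP sYD) // (subsetP nDX) // mem_gen.
right; rewrite expnS.
apply: leq_trans (card_proper_half (_ : <<Y>>%G \proper <<Z>>%G)); first by rewrite leq_mul2l.
rewrite properE sYZ /=; apply: contra nnY => sZY.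
rewrite gen_subG; apply/subsetP => x Xx; rewrite inE -genJ gen_subG.
apply/subsetP => _ /imsetP[y Yy ->]; apply: (subsetP sZY); rewrite mem_gen // inE.
by apply/orP; right; apply: imset2_f.
Qed.

(** A normal subgroup containing the commutators of the generators Y has abelian quotient, so it
    contains the derived subgroup. *)
Lemma word_ball_gen_der (G : {group gT}) (Y : {set gT}) c i m :
    <<X>> = G -> <<Y>> = G^`(i) -> Y \subset word_ball c -> (#|G^`(i.+1)| < 2 ^ m.+1)%N ->
  exists2 Z : {set gT}, <<Z>> = G^`(i.+1) & Z \subset word_ball (4 * c + 2 * m).
Proof.
move=> genX genY Yc ltD.
have sYi : Y \subset G^`(i) by rewrite -genY subset_gen.
apply: (@word_ball_gen_normal [set [~ y, z] | y in Y, z in Y] (G^`(i.+1))%G) => //.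
- by apply/subsetP => _ /imset2P[y z Yy Yz ->]; rewrite word_ball_commg // (subsetP Yc).
- apply/subsetP => _ /imset2P[y z Yy Yz ->].
  by apply: mem_commg; apply: (subsetP sYi).
- by rewrite genX normal_norm // der_normal.
move=> K nKX sSK; rewrite genX in nKX.
have nKY := subset_trans sYi (subset_trans (der_sub i G) nKX).
apply: (@der1_min _ G^`(i)%G K); first exact: subset_trans (der_sub i G) nKX.
rewrite /= -genY quotient_gen // abelian_gen.
apply/centsP => _ /morphimP[y Ny Yy ->] _ /morphimP[z Nz Yz ->].
apply/commgP; rewrite -morphR //; apply/eqP/coset_id.
by apply: (subsetP sSK); apply: imset2_f.
Qed.

(** Take a maximal M covered within its own bound. Adjoining a missing generator y costs one power
    of y below the exponent and at least doubles the index over K. *)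
Lemma word_ball_abelian_quotient (H K : {group gT}) (Y : {set gT}) c e :
    K <| H -> abelian (H / K) -> <<Y>> = H -> Y \subset word_ball c ->
    (exponent (H / K) <= e)%N ->
  H \subset word_ball (e * c * trunc_log 2 #|H : K|) * K.
Proof.
move=> nsKH abHK genY Yc le_e; have [sKH nKH] := andP nsKH.
pose P := fun M : {group gT} =>
  [&& K \subset M, M \subset H & M \subset word_ball (e * c * trunc_log 2 #|M : K|) * K].
have PK : P K.
  by rewrite /P subxx sKH /=; apply/subsetP => k Kk; rewrite -[k]mul1g mem_mulg ?word_ball_1.
have [M maxM _] := maxgroup_exists PK.
have [/and3P[sKM sMH Mb] maxP] := maxgroupP maxM.
suff sYM : Y \subset M.
  have defM : M :=: H by apply/eqP; rewrite eqEsubset sMH -genY gen_subG.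
  by rewrite -defM.
apply/subsetP => y Yy; apply: contraT => nMy.
have Hy : y \in H by rewrite -genY mem_gen.
have nsMH : M <| H.
  by apply: sub_der1_normal => //; apply: subset_trans sKM; apply: der1_min.
have nMy' : <[y]> \subset 'N(M) by rewrite cycle_subG (subsetP (normal_norm nsMH)).
have defM' : M <*> <[y]> = M * <[y]> := norm_joinEr nMy'.
have sMM' : M \subset M <*> <[y]> := joing_subl _ _.
case/negP: (nMy); rewrite -(maxP (M <*> <[y]>)%G _ sMM').
  by rewrite -cycle_subG joing_subr.
apply/and3P; split; first exact: subset_trans sKM sMM'.
  by rewrite join_subG sMH cycle_subG.
set l := trunc_log 2 #|M : K| in Mb.
have lt_l : (l < trunc_log 2 #|(M <*> <[y]>)%G : K|)%N.
  have idx := Lagrange_index sMM' sKM.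
  rewrite trunc_log_max // -idx expnS leq_mul ?trunc_logP //.
  by rewrite indexg_gt1 /= join_subG subxx cycle_subG.
move: lt_l; move: (trunc_log 2 #|_ : K|) => d lt_l.
rewrite /= defM'; apply/subsetP => _ /mulsgP[z _ Mz /cycleP[n ->] ->].
have /mulsgP[w k wb Kk ->] := subsetP Mb z Mz.
set s := exponent (H / K) in le_e.
have Ks : y ^+ s \in K.
  apply: coset_idr; first by rewrite groupX ?(subsetP nKH).
  by rewrite morphX ?(subsetP nKH) //= expg_exponent // mem_quotient.
have nKy : y ^+ (n %% s) \in 'N(K) by rewrite groupX ?(subsetP nKH).
rewrite (divn_eq n s) [X in y ^+ X]addnC expgD (mulnC (n %/ s)) expgM.
have Kz : k ^ (y ^+ (n %% s)) * (y ^+ s) ^+ (n %/ s) \in K.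
  by apply: groupM; [rewrite memJ_norm | apply: groupX].
set z' := (y ^+ s) ^+ _ in Kz *; set x := y ^+ (n %% s) in Kz nKy *.
(* Moves the factors from K to the right of the word [w * x]. *)
have -> : w * k * (x * z') = (w * x) * (k ^ x * z') by rewrite conjgE !mulgA mulgK.
apply: (mem_mulg _ Kz); apply: (subsetP (word_ball_sub (_ : e * c * l + e * c <= _)%N)).
  by rewrite -mulnSr leq_mul2l lt_l orbT.
apply: word_ballM => //.
apply: (subsetP (word_ball_sub (_ : n %% s * c <= _)%N)).
  by rewrite leq_mul2r (leq_trans _ le_e) ?orbT // ltnW // ltn_mod exponent_gt0.
by rewrite word_ballX // (subsetP Yc).
Qed.

Lemma word_ball_gen_der_bound (G : {group gT}) (N := trunc_log 2 #|G|) i :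
    <<X>> = G -> solvable G -> G :!=: 1 ->
  exists2 Y : {set gT}, <<Y>> = G^`(i) & Y \subset word_ball (4 ^ i * N).
Proof.
move=> genX solG ntG.
have ltG : (#|G| < 2 ^ N.+1)%N by apply: trunc_log_ltn.
have N_gt0 : (0 < N)%N by rewrite trunc_log_gt0 /= cardG_gt1.
(* The recursion c := 4 c + 2 (N - 1) multiplies 3 c + 2 (N - 1) by 4. *)
suff [c [Y [lec genY Yc]]] : exists c (Y : {set gT}),
    [/\ (3 * c + 2 * N.-1 <= 4 ^ i * (2 * N + 1))%N, <<Y>> = G^`(i) & Y \subset word_ball c].
  exists Y => //; apply: subset_trans Yc (word_ball_sub _).
  (* As N >= 1, 2 N + 1 <= 3 N. *)
  have : (0 < 4 ^ i)%N by rewrite expn_gt0.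
  by move: lec; move: (4 ^ i)%N => x; nia.
elim: i => [|i [c [Y [lec genY Yc]]]].
  exists 1%N, X; rewrite genX derg0; split=> //; first by rewrite expn0; lia.
  by apply/subsetP => x; apply: mem_word_ball1.
have [|Z genZ Zb] := @word_ball_gen_der G Y c i N.-1 genX genY Yc; last first.
  exists (4 * c + 2 * N.-1)%N, Z; split=> //.
  by rewrite expnS; move: lec; move: (4 ^ i)%N => x; lia.
(* [N.-1] rounds suffice since a proper derived subgroup has at most half the order of G. *)
rewrite prednK // -(ltn_pmul2l (isT : 0 < 2)%N) -expnS (leq_ltn_trans _ ltG) //.
apply: leq_trans (card_proper_half (sol_der1_proper solG (subxx G) ntG)).
by rewrite leq_mul2l subset_leq_card // der_subn.
Qed.

(** Descend the derived series: the radii add up, and the logarithms of the successive indices sum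
    to at most N. The second factor N comes from the length of the generators. *)
Lemma word_ball_solvable (G : {group gT}) (N := trunc_log 2 #|G|) L e :
    <<X>> = G -> solvable G -> (0 < L)%N -> G :!=: 1 -> G^`(L) = 1 ->
    (forall i, (i < L)%N -> exponent (G^`(i) / G^`(i.+1)) <= e)%N ->
  G \subset word_ball (e * 4 ^ L.-1 * N ^ 2).
Proof.
move=> genX solG L_gt0 ntG derL le_e.
have step i : (i <= L)%N ->
    G \subset word_ball (e * (4 ^ L.-1 * N) * trunc_log 2 #|G : G^`(i)|) * G^`(i).
  elim: i => [|i IHi] lei.
    by rewrite derg0; apply/subsetP => g Gg; rewrite -[g]mul1g mem_mulg ?word_ball_1.
  apply: subset_trans (IHi (ltnW lei)) _.
  have [Y genY Yb] := word_ball_gen_der_bound i genX solG ntG.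
  have Yb' : Y \subset word_ball (4 ^ L.-1 * N).
    apply: subset_trans Yb (word_ball_sub _); rewrite leq_mul2r leq_exp2l //.
    by rewrite -ltnS prednK // lei orbT.
  have sub := word_ball_abelian_quotient
    (der_normalS i G) (der_abelian i G) genY Yb' (le_e i lei).
  apply: subset_trans (mulgS _ sub) _.
  rewrite mulgA mulSg // /word_ball -expgD word_ball_sub // -mulnDr leq_mul2l.
  apply/orP; right; apply: trunc_log_max => //.
  rewrite expnD -(Lagrange_index (der_sub i G) (der_subS i G)).
  by rewrite leq_mul // trunc_logP.
have := step L (leqnn L); rewrite derL mulg1 indexg1 -/N.
by rewrite mulnA -!mulnA mulnn mulnA.
Qed.

End Ball.

Lemma word_ball_word (gT : finGroupType) (X : {set gT}) k g : g \in word_ball X k ->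
  exists2 w, is_word X g w & (size w <= k)%N.
Proof.
elim: k g => [|k IHk] g.
  rewrite /word_ball expg0 inE => /eqP->; exists [::] => //.
  by split; rewrite ?big_nil.
rewrite /word_ball expgS => /mulsgP[x h xX /IHk[w [wX defh] lew] ->].
case/setU1P: xX => [-> | xX].
  by exists w; [split; rewrite ?mul1g | apply: leqW].
exists (x :: w) => //; split; last by rewrite big_cons defh.
by move=> y; rewrite inE => /predU1P[-> | /wX].
Qed.

Lemma eps0_le_exponent (gT : finGroupType) (G : {group gT}) : (eps0 G <= exponent G)%N.
Proof.
rewrite /eps0; case: ifP => _; first exact: exponent_gt0.
apply/bigmax_leqP => i _; apply: dvdn_leq (exponent_gt0 G) _.
exact: dvdn_trans (exponent_quotient _ _) (exponentS (der_sub i G)).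
Qed.

Lemma word_ball_eps0 (gT : finGroupType) (G : {group gT}) (X : {set gT}) :
    solvable G -> <<X>> = G ->
  G \subset word_ball X (eps0 G * 4 ^ (derived_length G).-1 * trunc_log 2 #|G| ^ 2).
Proof.
move=> solG genX; have [derL _] := derived_lengthP solG.
have [G1 | ntG] := eqVneq (G : {set gT}) 1.
  by rewrite {1}G1 sub1set word_ball_1.
have L_gt0 : (0 < derived_length G)%N.
  by rewrite lt0n; apply: contraNneq ntG => L0; rewrite -derL L0.
apply: word_ball_solvable => // i lti; rewrite /eps0 eqn0Ngt L_gt0 /=.
exact: (leq_bigmax (Ordinal lti)).
Qed.

Lemma derived_length_le (gT : finGroupType) (G : {group gT}) : solvable G -> G :!=: 1 ->
  (2 ^ derived_length G <= 32 * trunc_log 2 #|G| ^ 3)%N.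
Proof.
move=> solG ntG; have [_ minL] := derived_lengthP solG.
have := minL _ (solvable_der_card solG); set N := trunc_log 2 #|G| => le_L.
have N_gt0 : (0 < N)%N by rewrite trunc_log_gt0 /= cardG_gt1.
have le1 : (2 ^ trunc_log 2 (16 * N ^ 2) <= 16 * N ^ 2)%N.
  by rewrite trunc_logP // muln_gt0 expn_gt0 N_gt0.
have le2 : (2 ^ (trunc_log 2 N).+1 <= 2 * N)%N by rewrite expnS leq_mul2l trunc_logP.
apply: leq_trans (leq_pexp2l (isT : 0 < 2)%N le_L) _; rewrite expnD.
by apply: leq_trans (leq_mul le1 le2) _; rewrite mulnACA -expnSr.
Qed.

(* Passage to real logarithms and extended real diameters *)
From mathcomp Require Import all_classical all_reals all_analysis.
Import Order.TTheory GRing.Theory Num.Theory.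
Local Open Scope ring_scope.

Lemma trunc_log_le_log2 (R : realType) n : (0 < n)%N ->
  (trunc_log 2 n)%:R <= log2 (n%:R : R).
Proof.
move=> n_gt0; have ln2_gt0 : 0 < ln (2 : R) by rewrite ln_gt0 // ltr1n.
rewrite /log2 ler_pdivlMr // mulr_natl -lnXn ?ltr0n // -natrX.
by rewrite ler_ln ?posrE ?ltr0n ?expn_gt0 // ler_nat trunc_logP.
Qed.

Lemma diam_le (R : realType) (gT : finGroupType) (G : {set gT}) k :
    (forall X : {set gT}, <<X>>%g = G -> G \subset word_ball X k) ->
  (diam R G <= k%:R%:E)%E.
Proof.
move=> Gk; apply/bigmax_leP; split=> [|X /eqP genX]; first exact: leNye.
apply/bigmax_leP; split=> [|g Gg]; first exact: leNye.
have [w w_g lew] := word_ball_word (fintype.subsetP (Gk X genX) g Gg).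
apply: (@le_trans _ _ (size w)%:R%:E); last by rewrite lee_fin ler_nat.
by apply: ereal_inf_lbound; exists w.
Qed.

Theorem theorem1p2 (R : realType) (gT : finGroupType) (G : {group gT})
    (solG : solvable G) :
  [/\ (eps0 G <= exponent G)%N,
      (diam R G <= ((eps0 G)%:R * 4 ^ ((derived_length G)%:Z - 1)
                      * log2 (#|G|%:R : R) ^+ 2)%:E)%E
    & (eps0 G)%:R * 4 ^ ((derived_length G)%:Z - 1) * log2 (#|G|%:R : R) ^+ 2
        <= (eps0 G)%:R * (4 * log2 (#|G|%:R : R)) ^+ 8].
Proof.
set l := log2 _; pose N := trunc_log 2 #|G|.
have leNl : N%:R <= l by rewrite trunc_log_le_log2.
have l_ge0 : 0 <= l by apply: le_trans leNl; apply: ler0n.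
have leX n : (N ^ n)%:R <= l ^+ n by rewrite natrX lerXn2r // nnegrE ?ler0n.
have diamG := diam_le R (fun X genX => word_ball_eps0 solG genX).
(* For trivial G the integer exponent of 4 is -1, but the logarithm is 0 and so are all the
   bounds. *)
have [G1 | ntG] := eqVneq (G : {set gT}) 1%g.
  have l0 : l = 0 by rewrite /l G1 cards1 /log2 ln1 mul0r.
  split; first exact: eps0_le_exponent.
    by apply: le_trans diamG _; rewrite l0 G1 cards1 expr0n /= !mulr0 muln0.
  by rewrite l0 mulr0 !expr0n /= !mulr0.
clearbody l; have [derL _] := derived_lengthP solG.
have L_gt0 : (0 < derived_length G)%N.
  by rewrite lt0n; apply: contraNneq ntG => L0; rewrite -derL L0.
have -> : (derived_length G)%:Z - 1 = (derived_length G).-1%:Z.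
  by rewrite -[in LHS](prednK L_gt0) -addn1 PoszD addrK.
rewrite -exprnP; split; first exact: eps0_le_exponent.
  apply: le_trans diamG _; rewrite lee_fin 2!natrM natrX.
  by apply: ler_wpM2l (leX 2); rewrite mulr_ge0 ?exprn_ge0.
rewrite -mulrA ler_wpM2l // exprMn.
(* Squaring 2 ^ (L - 1) <= 16 N ^ 3 gives 4 ^ 4 * N ^ 6, with room to spare below 4 ^ 8 * N ^ 6. *)
have le4 : (4 ^ (derived_length G).-1 <= 4 ^ 8 * N ^ 6)%N.
  rewrite -[4%N]/(2 ^ 2)%N -expnM mulnC expnM.
  have leL : (2 ^ (derived_length G).-1 <= 16 * N ^ 3)%N.
    rewrite -(leq_pmul2l (isT : 0 < 2)%N) mulnA -expnS prednK //.
    exact: derived_length_le.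
  apply: (@leq_trans ((16 * N ^ 3) ^ 2)%N); first by rewrite leq_exp2r.
  by rewrite expnMn -expnM leq_mul2r (_ : 16 ^ 2 <= (2 ^ 2) ^ 8)%N ?orbT // -expnM leq_exp2l.
apply: (@le_trans _ _ ((4 ^ 8 * N ^ 6)%N%:R * l ^+ 2)).
  by apply: ler_wpM2r; rewrite ?exprn_ge0 // -natrX ler_nat.
by rewrite natrM natrX -mulrA ler_wpM2l ?exprn_ge0 // (exprD l 6 2) ler_wpM2r ?exprn_ge0.
Qed.
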